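(* Let $n\ge2$, let $(\mathcal{N},[\cdot,\ldots,\cdot])$ and $(\mathcal{N}',[\cdot,\ldots,\cdot]')$ be two $n$-Lie algebras over $\mathbb{K}$ and let $\phi:\mathcal{N}\to\mathcal{N}'$ be an $n$-Lie algebra morphism. For $m\ge0$ let $\delta^{m+1}:C^m(\mathcal{N},\mathcal{N}')\to C^{m+1}(\mathcal{N},\mathcal{N}')$ be the coboundary operator defined, for $x_1,\ldots,x_{m+1}\in\mathcal{L}(\mathcal{N})=\wedge^{n-1}\mathcal{N}$, $x_{m+1}=x_{m+1}^1\wedge\cdots\wedge x_{m+1}^{n-1}$, and $z\in\mathcal{N}$, by $$\begin{aligned}\delta^{m+1}f(x_1,\ldots,x_{m+1},z)=&\sum_{1\le i<j\le m+1}(-1)^i f(x_1,\ldots,\widehat{x}_i,\ldots,x_{j-1},[x_i,x_j],\ldots,x_{m+1},z)\\&+\sum_{i=1}^{m+1}(-1)^i f(x_1,\ldots,\widehat{x}_i,\ldots,x_{m+1},ad(x_i).z)\\&+\sum_{i=1}^{m+1}(-1)^{i+1}L'(x_i).f(x_1,\ldots,\widehat{x}_i,\ldots,x_{m+1},z)\\&+(-1)^m\sum_{i=1}^{n-1}[\phi(x_{m+1}^1),\ldots,f(x_1,\ldots,x_m,x_{m+1}^i),\ldots,\phi(x_{m+1}^{n-1}),\phi(z)]',\end{aligned}$$ where in the last sum $f(x_1,\ldots,x_m,x_{m+1}^i)$ occupies the $i$-th slot. Then $\delta^{m+2}\circ\delta^{m+1}=0$ for all $m\ge0$.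
   Context: $\mathbb{K}$ is an algebraically closed field of characteristic $0$; all vector spaces are over $\mathbb{K}$. An $n$-Lie algebra is a vector space $\mathcal{N}$ with a skew-symmetric $n$-linear bracket satisfying the Nambu identity $[x_1,\ldots,x_{n-1},[y_1,\ldots,y_n]]=\sum_{i=1}^n[y_1,\ldots,y_{i-1},[x_1,\ldots,x_{n-1},y_i],y_{i+1},\ldots,y_n]$. A morphism of $n$-Lie algebras is a linear map $f$ with $f([x_1,\ldots,x_n])=[f(x_1),\ldots,f(x_n)]'$. Put $\mathcal{L}(\mathcal{N})=\wedge^{n-1}\mathcal{N}$. For $x=x^1\wedge\cdots\wedge x^{n-1}$ and $y=y^1\wedge\cdots\wedge y^{n-1}$ in $\mathcal{L}(\mathcal{N})$: $ad(x).z=[x^1,\ldots,x^{n-1},z]$ for $z\in\mathcal{N}$; $L'(x).w=[\phi(x^1),\ldots,\phi(x^{n-1}),w]'$ for $w\in\mathcal{N}'$; $[x,y]=\sum_{i=1}^{n-1}y^1\wedge\cdots\wedge(ad(x).y^i)\wedge\cdots\wedge y^{n-1}$. The space of $(m+1)$-cochains $C^m(\mathcal{N},\mathcal{N}')$ is the space of linear maps $f:\otimes^m\mathcal{L}(\mathcal{N})\wedge\mathcal{N}\to\mathcal{N}'$: for $m=0$ these are linear maps $\mathcal{N}\to\mathcal{N}'$, and for $m\ge1$ they are linear maps $f(x_1,\ldots,x_m,z)$ on $\mathcal{L}(\mathcal{N})^{\otimes m}\otimes\mathcal{N}$ that are skew-symmetric in the $n$ arguments $x_m^1,\ldots,x_m^{n-1},z$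 (where $x_m=x_m^1\wedge\cdots\wedge x_m^{n-1}$). *)

(* Defs.v *)
From HB Require Import structures.
From mathcomp.multinomials Require Import freeg.
From mathcomp Require Import all_boot all_algebra perm ring_quotient zify.
From mathcomp Require Import boolp.

Set Implicit Arguments.
Unset Strict Implicit.
Unset Printing Implicit Defensive.

Import GRing.Theory.
Local Open Scope ring_scope.
Local Open Scope quotient_scope.

(* Vectors (x_1, ..., x_n) are finite functions T ^ n = {ffun 'I_n -> T};
   indices start at 0. *)
Section Vectors.
Variables (T : Type) (n : nat).
Implicit Types x : T ^ n.

Definition upd x (i : 'I_n) (v : T) : T ^ n :=
  [ffun j => if j == i then v else x j].

Definition swap (i j : 'I_n) x : T ^ n := [ffun k => x (tperm i j k)].

(* (x_1, ..., x_(n-1), z); the last index of 'I_n is not in 'I_n.-1. *)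
Definition snoc (x : T ^ n.-1) (z : T) : T ^ n :=
  [ffun i : 'I_n => oapp x z (insub (val i))].

Definition front (y : T ^ n.+1) : T ^ n := [ffun i => y (lift ord_max i)].

Definition omit (i : 'I_n.+1) (y : T ^ n.+1) : T ^ n := [ffun j => y (lift i j)].

Lemma updE x i v j : upd x i v j = if j == i then v else x j.
Proof. exact: ffunE. Qed.

Lemma swapE x i j k : swap i j x k = x (tperm i j k).
Proof. exact: ffunE. Qed.

Lemma upd_upd x i v w : upd (upd x i v) i w = upd x i w.
Proof. by apply/ffunP=> j; rewrite !ffunE; case: eqP. Qed.

Lemma updC x i j v w : i != j -> upd (upd x i v) j w = upd (upd x j w) i v.
Proof.
move=> ne; apply/ffunP=> k; rewrite !ffunE.
by case: eqP => // ->; rewrite eq_sym (negPf ne).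
Qed.

Lemma upd_eq x i v : upd x i v i = v.
Proof. by rewrite ffunE eqxx. Qed.

Lemma upd_neq x i j v : i != j -> upd x i v j = x j.
Proof. by move=> ne; rewrite ffunE eq_sym (negPf ne). Qed.

Lemma upd_swap x i j p v :
  upd (swap i j x) p v = swap i j (upd x (tperm i j p) v).
Proof. by apply/ffunP=> k; rewrite !ffunE (inj_eq perm_inj). Qed.

End Vectors.

Definition vmap (T U : Type) n (f : T -> U) (x : T ^ n) : U ^ n :=
  [ffun i => f (x i)].

Section VectorLemmas.
Variables (T : Type) (n : nat).

Lemma snocE_last (x : T ^ n) z : (@snoc T n.+1 x z) ord_max = z.
Proof. by rewrite ffunE insubF //= ltnn. Qed.

Lemma snocE_lift (x : T ^ n) z i : (@snoc T n.+1 x z) (lift ord_max i) = x i.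
Proof.
by rewrite ffunE [val (lift _ _)]lift_max valK.
Qed.

Lemma snoc_upd (x : T ^ n) i v z :
  @snoc T n.+1 (upd x i v) z = upd (@snoc T n.+1 x z) (lift ord_max i) v.
Proof.
apply/ffunP=> k; case: (unliftP ord_max k) => [k'|] ->.
  by rewrite snocE_lift !updE (inj_eq lift_inj) snocE_lift.
by rewrite snocE_last upd_neq ?snocE_last // eq_sym neq_lift.
Qed.

Lemma snoc_updr (x : T ^ n) z w :
  @snoc T n.+1 x w = upd (@snoc T n.+1 x z) ord_max w.
Proof.
apply/ffunP=> k; case: (unliftP ord_max k) => [k'|] ->.
  by rewrite upd_neq ?neq_lift // !snocE_lift.
by rewrite upd_eq snocE_last.
Qed.

Lemma snoc_front (y : T ^ n.+1) : @snoc T n.+1 (front y) (y ord_max) = y.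
Proof.
apply/ffunP=> k; case: (unliftP ord_max k) => [k'|] ->.
  by rewrite snocE_lift ffunE.
by rewrite snocE_last.
Qed.

Lemma front_upd_lift (y : T ^ n.+1) i v :
  front (upd y (lift ord_max i) v) = upd (front y) i v.
Proof. by apply/ffunP=> k; rewrite !ffunE (inj_eq lift_inj). Qed.

Lemma front_upd_last (y : T ^ n.+1) v : front (upd y ord_max v) = front y.
Proof. by apply/ffunP=> k; rewrite !ffunE eq_sym (negPf (neq_lift _ _)). Qed.

Lemma tperm_lift (p : 'I_n.+1) i j k :
  tperm (lift p i) (lift p j) (lift p k) = lift p (tperm i j k).
Proof.
case: (tpermP i j k) => [->|->|nei nej]; rewrite ?tpermL ?tpermR //.
by rewrite tpermD // (inj_eq lift_inj) eq_sym; apply/eqP.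
Qed.

Lemma snoc_swap (x : T ^ n) i j z :
  @snoc T n.+1 (swap i j x) z =
  swap (lift ord_max i) (lift ord_max j) (@snoc T n.+1 x z).
Proof.
apply/ffunP=> k; case: (unliftP ord_max k) => [k'|] ->.
  by rewrite snocE_lift !swapE tperm_lift snocE_lift.
rewrite snocE_last swapE tpermD ?snocE_last //.
  by rewrite eq_sym neq_lift.
by rewrite eq_sym neq_lift.
Qed.

Lemma omit_upd_lift p (x : T ^ n.+1) i v :
  omit p (upd x (lift p i) v) = upd (omit p x) i v.
Proof. by apply/ffunP=> k; rewrite !ffunE (inj_eq lift_inj). Qed.

Lemma omit_upd p (x : T ^ n.+1) v : omit p (upd x p v) = omit p x.
Proof. by apply/ffunP=> k; rewrite !ffunE eq_sym (negPf (neq_lift _ _)). Qed.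

Lemma vmap_upd (U : Type) (f : T -> U) (x : T ^ n) i v :
  vmap f (upd x i v) = upd (vmap f x) i (f v).
Proof. by apply/ffunP=> k; rewrite !ffunE; case: eqP. Qed.

Lemma vmap_swap (U : Type) (f : T -> U) (x : T ^ n) i j :
  vmap f (swap i j x) = swap i j (vmap f x).
Proof. by apply/ffunP=> k; rewrite !ffunE. Qed.

End VectorLemmas.

Section Multilinear.
Variables (K : fieldType) (N W : lmodType K) (n : nat).
Implicit Type g : N ^ n -> W.

Definition multilinear g := forall x i, linear (fun v => g (upd x i v)).

Definition skew_symmetric g := forall x i j, i != j -> g (swap i j x) = - g x.

End Multilinear.

Section LinearLemmas.
Variables (K : fieldType) (U V W : lmodType K).

Lemma lin_add (f g : U -> W) :
  linear f -> linear g -> linear (fun u => f u + g u).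
Proof.
by move=> hf hg a u v; rewrite hf hg scalerDr addrACA.
Qed.

Lemma lin_scale a (f : U -> W) : linear f -> linear (fun u => a *: f u).
Proof. by move=> hf b u v; rewrite hf scalerDr !scalerA mulrC. Qed.

Lemma lin_sum (I : finType) (P : pred I) (F : I -> U -> W) :
  (forall i, P i -> linear (F i)) -> linear (fun u => \sum_(i | P i) F i u).
Proof.
move=> hF a u v; rewrite scaler_sumr -big_split /=.
by apply: eq_bigr => i Pi; apply: hF.
Qed.

Lemma lin_comp (f : V -> W) (g : U -> V) :
  linear f -> linear g -> linear (fun u => f (g u)).
Proof. by move=> hf hg a u v; rewrite hg hf. Qed.

Lemma lin_ext (f g : U -> W) : f =1 g -> linear g -> linear f.
Proof. by move=> e hg a u v; rewrite !e hg. Qed.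

Lemma big_ord_lift k (F : 'I_k.+1 -> W) :
  \sum_(i < k.+1) F i = \sum_(i < k) F (lift ord_max i) + F ord_max.
Proof.
rewrite big_ord_recr; congr (_ + _); apply: eq_bigr => i _; congr (F _).
by apply: val_inj; apply: esym; apply: lift_max.
Qed.

Lemma lift_ord_max_inv m (i q : 'I_m) :
  lift (lift ord_max i) q = ord_max -> q.+1 = m.
Proof.
move/(congr1 val); rewrite /= /bump; have := ltn_ord i; have := ltn_ord q.
by case: leqP; case: leqP; lia.
Qed.

Section SkewLemmas.
Variable k : nat.
Implicit Types g h : U ^ k -> W.

Lemma skew_ext g h : g =1 h -> skew_symmetric h -> skew_symmetric g.
Proof. by move=> e hh x i j ne; rewrite !e hh. Qed.

Lemma skew_add g h :
  skew_symmetric g -> skew_symmetric h -> skew_symmetric (fun x => g x + h x).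
Proof. by move=> hg hh x i j ne; rewrite hg // hh // opprD. Qed.

Lemma skew_scale a g : skew_symmetric g -> skew_symmetric (fun x => a *: g x).
Proof. by move=> hg x i j ne; rewrite hg // scalerN. Qed.

Lemma skew_sum (I : finType) (P : pred I) (F : I -> U ^ k -> W) :
  (forall i, P i -> skew_symmetric (F i)) ->
  skew_symmetric (fun x => \sum_(i | P i) F i x).
Proof.
move=> hF x i j ne; rewrite -sumrN.
by apply: eq_bigr => p Pp; apply: hF.
Qed.

Lemma lin0 (f : V -> W) : linear f -> f 0 = 0.
Proof. by move=> hf; have := hf (-1) 0 0; rewrite scaler0 addr0 scaleN1r addNr. Qed.

Lemma lin_opp (f : V -> W) : linear f -> {morph f : x / - x}.
Proof.
by move=> hf x; have := hf (-1) x 0; rewrite lin0 // !addr0 !scaleN1r.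
Qed.

Lemma lin_bigsum (f : V -> W) (I : finType) (P : pred I) (F : I -> V) :
  linear f -> f (\sum_(i | P i) F i) = \sum_(i | P i) f (F i).
Proof.
move=> hf; apply: (big_morph f) => [x y|]; last exact: lin0.
by have := hf 1 x y; rewrite !scale1r.
Qed.

Lemma skew_lin (f : V -> W) (g : U ^ k -> V) :
  linear f -> skew_symmetric g -> skew_symmetric (fun x => f (g x)).
Proof. by move=> hf hg x i j ne; rewrite hg // lin_opp. Qed.

End SkewLemmas.

Section Derivation.
Variables (k : nat) (g : V ^ k -> W) (phi F : U -> V).
Hypotheses (g_lin : multilinear g) (g_skew : skew_symmetric g).

Let deriv (y : U ^ k) := \sum_(p < k) g (upd (vmap phi y) p (F (y p))).

Lemma deriv_multilinear : linear phi -> linear F -> multilinear deriv.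
Proof.
move=> hphi hF x i; apply: lin_sum => p _.
have [<-|ne] := eqVneq i p.
  apply: (@lin_ext _ (fun v => g (upd (vmap phi x) i (F v)))) => [v|].
    by rewrite vmap_upd upd_upd upd_eq.
  exact: (lin_comp (g_lin (vmap phi x) i) hF).
apply: (@lin_ext _ (fun v => g (upd (upd (vmap phi x) p (F (x p))) i (phi v)))).
  by move=> v; rewrite vmap_upd updC // upd_neq.
exact: (lin_comp (g_lin (upd (vmap phi x) p (F (x p))) i) hphi).
Qed.

Lemma deriv_skew : skew_symmetric deriv.
Proof.
move=> x i j ne; rewrite /deriv -sumrN.
rewrite (reindex_inj (@perm_inj _ (tperm i j))) /=; apply: eq_bigr => p _.
by rewrite vmap_swap upd_swap tpermK g_skew // [swap _ _ x _]ffunE tpermK.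
Qed.

End Derivation.

End LinearLemmas.

HB.mixin Record isNLie (K : fieldType) (n : nat) N of GRing.Lmodule K N := {
  nbracket : N ^ n -> N;
  nbracket_multilinear : multilinear nbracket;
  nbracket_skew : skew_symmetric nbracket;
  nbracket_nambu : forall (x : N ^ n.-1) (y : N ^ n),
    nbracket (snoc x (nbracket y)) =
    \sum_(i < n) nbracket (upd y i (nbracket (snoc x (y i))))
}.

#[short(type="nLieType")]
HB.structure Definition NLie (K : fieldType) (n : nat) :=
  {N of GRing.Lmodule K N & isNLie K n N}.

Definition nLie_morphism (K : fieldType) n (N N' : nLieType K n)
    (phi : {linear N -> N'}) :=
  forall x : N ^ n, phi (nbracket x) = nbracket (vmap phi x).

(* The n-th exterior power, as the quotient of the free vector space on N ^ n
   by the span of the relators expressing multilinearity and skew-symmetry.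
   As soon as 2 is invertible, skew-symmetry amounts to the vanishing of
   x_1 /\ ... /\ x_n when x_i = x_j (lemma wedge_alt below). *)
Section ExteriorPower.
Variables (K : fieldType) (n : nat) (N : lmodType K).

Local Notation free := {freeg (N ^ n)%type / K}.

Variant wedge_relator : free -> Prop :=
  | RelLinear (x : N ^ n) i a u v :
      wedge_relator (<< upd x i (a *: u + v) >>
                     - (a *: << upd x i u >> + << upd x i v >>))
  | RelSkew (x : N ^ n) i j :
      i != j -> wedge_relator (<< swap i j x >> + << x >>).

Inductive wedge_span : free -> Prop :=
  | Span0 : wedge_span 0
  | SpanZD a r x : wedge_relator r -> wedge_span x -> wedge_span (a *: r + x).

Definition wedge_null : {pred free} := fun x => `[< wedge_span x >].

Lemma wedge_spanD x y : wedge_span x -> wedge_span y -> wedge_span (x + y).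
Proof.
move=> sx sy; elim: x / sx => [|a r x hr _ IH]; first by rewrite add0r.
by rewrite -addrA; apply: SpanZD.
Qed.

Lemma wedge_spanZ a x : wedge_span x -> wedge_span (a *: x).
Proof.
elim=> [|b r {}x hr _ IH]; first by rewrite scaler0; apply: Span0.
by rewrite scalerDr scalerA; apply: SpanZD.
Qed.

Lemma wedge_null_zmod : zmod_closed wedge_null.
Proof.
split; first by apply/asboolP/Span0.
move=> x y /asboolP sx /asboolP sy; apply/asboolP.
by rewrite -scaleN1r; apply: wedge_spanD => //; apply: wedge_spanZ.
Qed.

HB.instance Definition _ := GRing.isZmodClosed.Build free wedge_null
  wedge_null_zmod.

Definition extpow : Type := Quotient.quot wedge_null.

HB.instance Definition _ := GRing.Zmodule.on extpow.

Definition extpow_pi (x : free) : extpow := \pi_(Quotient.quot wedge_null) x.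
Definition extpow_repr (x : extpow) : free :=
  repr (x : Quotient.quot wedge_null).

Lemma extpow_reprK : cancel extpow_repr extpow_pi.
Proof. by move=> x; apply: reprK. Qed.

Lemma extpow_piD : {morph extpow_pi : x y / x + y}.
Proof. by move=> x y; rewrite /extpow_pi Quotient.pi_add. Qed.

Lemma extpow_pi_eq x y : wedge_span (x - y) <-> extpow_pi x = extpow_pi y.
Proof.
rewrite /extpow_pi; split.
  by move=> h; apply/eqP; rewrite -Quotient.idealrBE; apply/asboolP.
by move/eqP; rewrite -Quotient.idealrBE => /asboolP.
Qed.

Definition extpow_scale (a : K) (x : extpow) : extpow :=
  extpow_pi (a *: extpow_repr x).

Lemma extpow_piZ a x : extpow_pi (a *: x) = extpow_scale a (extpow_pi x).
Proof.
apply/extpow_pi_eq; rewrite -scalerBr; apply: wedge_spanZ.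
by apply/extpow_pi_eq; rewrite extpow_reprK.
Qed.

Lemma extpow_scaleA a b x :
  extpow_scale a (extpow_scale b x) = extpow_scale (a * b) x.
Proof. by rewrite -(extpow_reprK x) -!extpow_piZ scalerA. Qed.

Lemma extpow_scale1 : left_id 1 extpow_scale.
Proof. by move=> x; rewrite -(extpow_reprK x) -!extpow_piZ scale1r. Qed.

Lemma extpow_scaleDr : right_distributive extpow_scale +%R.
Proof.
move=> a x y; rewrite -(extpow_reprK x) -(extpow_reprK y).
by rewrite -!(extpow_piD, extpow_piZ) scalerDr.
Qed.

Lemma extpow_scaleDl x :
  {morph extpow_scale^~ x : a b / a + b}.
Proof.
move=> a b /=; rewrite -(extpow_reprK x).
by rewrite -!(extpow_piD, extpow_piZ) scalerDl.
Qed.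

HB.instance Definition _ := GRing.Zmodule_isLmodule.Build K extpow
  extpow_scaleA extpow_scale1 extpow_scaleDr extpow_scaleDl.

Definition wedge (x : N ^ n) : extpow := extpow_pi << x >>.

(* The linear extension of a map given on decomposable elements.  When g is
   multilinear and skew-symmetric it is the linear map characterised by
   extlift g (wedge x) = g x (lemmas extlift_linear, extlift_wedge and
   extpow_ind); otherwise its value has no meaning. *)
Definition extlift (W : lmodType K) (g : N ^ n -> W) (x : extpow) : W :=
  fglift g (extpow_repr x).

Lemma extpow_piB : {morph extpow_pi : x y / x - y}.
Proof.
move=> x y; rewrite extpow_piD; congr (_ + _).
by rewrite -scaleN1r extpow_piZ -[RHS]scaleN1r.
Qed.

Lemma wedge_relatorW r : wedge_relator r -> wedge_span r.
Proof.
by move=> hr; rewrite -[r]addr0 -[r in r + 0]scale1r; apply: SpanZD hr Span0.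
Qed.

Lemma wedge_multilinear : multilinear wedge.
Proof.
move=> x i a u v; rewrite -[a *: wedge _]extpow_piZ -extpow_piD.
by apply/extpow_pi_eq/wedge_relatorW/RelLinear.
Qed.

Lemma wedge_skew : skew_symmetric wedge.
Proof.
move=> x i j neq_ij; apply/eqP; rewrite -addr_eq0 -extpow_piD.
have -> : 0 = extpow_pi 0 by rewrite -(subrr (0 : free)) extpow_piB subrr.
by apply/eqP/extpow_pi_eq; rewrite subr0; apply/wedge_relatorW/RelSkew.
Qed.

Lemma extpow_ind (P : extpow -> Prop) :
  P 0 -> (forall a t x, P x -> P (a *: wedge t + x)) -> forall x, P x.
Proof.
move=> P0 PZD x; rewrite -(extpow_reprK x) -[extpow_repr x]freeg_sumE.
elim: (dom _) => [|t s IH].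
  by rewrite big_nil -(subrr (0 : free)) extpow_piB subrr.
rewrite big_cons extpow_piD; set a := coeff _ _.
suff -> : extpow_pi << a *g t >> = a *: wedge t by apply: PZD.
rewrite -[RHS]extpow_piZ; congr extpow_pi; apply/eqP/freeg_eqP => u.
by rewrite coeffZ !coeffU mul1r.
Qed.

Lemma wedge_alt (x : N ^ n) i j :
  (2%:R : K) != 0 -> i != j -> x i = x j -> wedge x = 0.
Proof.
move=> nz2 neq_ij eq_x; have := wedge_skew x neq_ij.
have -> : swap i j x = x.
  by apply/ffunP=> k; rewrite ffunE; case: tpermP => [->|->|].
move/eqP; rewrite -addr_eq0 -mulr2n -scaler_nat scaler_eq0 (negPf nz2).
by move/eqP.
Qed.

Section Extension.
Variable W : lmodType K.
Implicit Types g h : N ^ n -> W.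

Lemma fglift_sum g D : fglift g D = \sum_(x <- dom D) coeff x D *: g x.
Proof. by rewrite -{1}(Freeg_dom D) fglift_Freeg /prelift big_map. Qed.

Lemma fglift0 g : fglift g 0 = 0.
Proof. by rewrite -(subrr (0 : free)) lift_is_additive subrr. Qed.

Lemma fgliftD g : {morph fglift g : x y / x + y}.
Proof.
move=> x y; rewrite -{1}(opprK y) lift_is_additive -(sub0r y).
by rewrite lift_is_additive fglift0 sub0r opprK.
Qed.

Lemma fgliftZ g a x : fglift g (a *: x) = a *: fglift g x.
Proof.
rewrite [a *: x]/(fgscale a x) /fgscale (fglift_sum g x) scaler_sumr.
elim: (dom x) => [|t s IH]; first by rewrite !big_nil fglift0.
by rewrite !big_cons fgliftD IH liftU scalerA.
Qed.

Lemma eq_extlift g h : g =1 h -> extlift g =1 extlift h.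
Proof.
by move=> e x; rewrite /extlift !fglift_sum; apply: eq_bigr => t _; rewrite e.
Qed.

Lemma extlift_linearl a g h x :
  extlift (fun t => a *: g t + h t) x = a *: extlift g x + extlift h x.
Proof.
rewrite /extlift !fglift_sum scaler_sumr -big_split /=.
by apply: eq_bigr => t _; rewrite scalerDr !scalerA mulrC.
Qed.

Variable g : N ^ n -> W.
Hypotheses (g_lin : multilinear g) (g_skew : skew_symmetric g).

Lemma extlift_pi x : extlift g (extpow_pi x) = fglift g x.
Proof.
apply/eqP; rewrite -subr_eq0 -lift_is_additive.
have : wedge_span (extpow_repr (extpow_pi x) - x).
  by apply/extpow_pi_eq; rewrite extpow_reprK.
elim=> [|a r y hr _ /eqP IH]; first by rewrite fglift0.
rewrite fgliftD fgliftZ IH addr0; case: hr => [t i b u v|t i j neq_ij].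
  rewrite lift_is_additive fgliftD fgliftZ !liftU !scale1r.
  by rewrite (g_lin t i b u v) subrr scaler0.
by rewrite fgliftD !liftU !scale1r g_skew // addNr scaler0.
Qed.

Lemma extlift_wedge x : extlift g (wedge x) = g x.
Proof. by rewrite extlift_pi liftU scale1r. Qed.

Lemma extlift_linear : linear (extlift g).
Proof.
move=> a x y; rewrite -(extpow_reprK x) -(extpow_reprK y).
by rewrite -[a *: _]extpow_piZ -extpow_piD !extlift_pi fgliftD fgliftZ.
Qed.

End Extension.

End ExteriorPower.

Section Complex.
Variables (K : fieldType) (n : nat) (N N' : nLieType K n.+1).
Variable phi : {linear N -> N'}.

Local Notation L := (extpow n N).

Definition ad (x : L) (z : N) : N :=
  extlift (fun t : N ^ n => nbracket (@snoc N n.+1 t z)) x.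

Definition Lact (x : L) (w : N') : N' :=
  extlift (fun t : N ^ n => nbracket (@snoc N' n.+1 (vmap phi t) w)) x.

Definition Lbracket (x y : L) : L :=
  extlift (fun t : N ^ n => \sum_(i < n) wedge (upd t i (ad x (t i)))) y.

(* A linear map on L^{\otimes m} \otimes N is given as a map which is
   multilinear in the m + 1 arguments x_1, ..., x_m, z.  There is an i with
   i.+1 = m only for m >= 1, and it is then the index of x_m. *)
Record cochain m := Cochain {
  cochain_fun :> L ^ m -> N -> N';
  cochain_linear : forall xs, linear (cochain_fun xs);
  cochain_multilinear : forall z, multilinear (fun xs => cochain_fun xs z);
  cochain_skew : forall xs (i : 'I_m), i.+1 = m ->
    skew_symmetric (fun y : N ^ n.+1 =>
      cochain_fun (upd xs i (wedge (front y))) (y ord_max))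
}.

(* Indices start at 0, hence the signs shifted by one; the last term is
   extended linearly from decomposable x_(m+1): see delta_fun_wedge. *)
Definition delta_fun m (f : L ^ m -> N -> N') (xs : L ^ m.+1) (z : N) : N' :=
  \sum_(i < m.+1) \sum_(j < m.+1 | (i < j)%N)
     (-1) ^+ i.+1 *: f (omit i (upd xs j (Lbracket (xs i) (xs j)))) z
  + \sum_(i < m.+1) (-1) ^+ i.+1 *: f (omit i xs) (ad (xs i) z)
  + \sum_(i < m.+1) (-1) ^+ i.+2 *: Lact (xs i) (f (omit i xs) z)
  + (-1) ^+ m *:
    extlift (fun t : N ^ n =>
      \sum_(i < n) nbracket
        (@snoc N' n.+1 (upd (vmap phi t) i (f (omit ord_max xs) (t i))) (phi z)))
      (xs ord_max).

Let phi_linear : linear phi. Proof. exact: linearP. Qed.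

Section SnocLemmas.
Variable A : nLieType K n.+1.

Lemma snoc_multilinear (w : A) :
  multilinear (fun t : A ^ n => nbracket (@snoc A n.+1 t w)).
Proof.
move=> x i; apply: (lin_ext (fun v => congr1 _ (snoc_upd x i v w))).
exact: nbracket_multilinear.
Qed.

Lemma snoc_skew (w : A) :
  skew_symmetric (fun t : A ^ n => nbracket (@snoc A n.+1 t w)).
Proof.
by move=> x i j ne; rewrite snoc_swap nbracket_skew // (inj_eq lift_inj).
Qed.

Lemma snoc_linear (t : A ^ n) : linear (fun w => nbracket (@snoc A n.+1 t w)).
Proof.
apply: (lin_ext (fun w => congr1 _ (snoc_updr t 0 w))).
exact: nbracket_multilinear.
Qed.

End SnocLemmas.

Lemma ad_wedge t z : ad (wedge t) z = nbracket (@snoc N n.+1 t z).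
Proof. exact: (extlift_wedge (snoc_multilinear z) (snoc_skew z)). Qed.

Lemma ad_linearl z : linear (ad^~ z).
Proof. exact: (extlift_linear (snoc_multilinear z) (snoc_skew z)). Qed.

Lemma ad_linearr x : linear (ad x).
Proof.
move=> a u v; rewrite -extlift_linearl; apply: eq_extlift => t.
exact: snoc_linear.
Qed.

Lemma Lact_multilinear w :
  multilinear (fun t : N ^ n => nbracket (@snoc N' n.+1 (vmap phi t) w)).
Proof.
move=> x i; apply: (lin_ext (fun v => congr1 (fun t => nbracket
  (@snoc N' n.+1 t w)) (vmap_upd phi x i v))).
exact: (lin_comp (@snoc_multilinear N' w (vmap phi x) i) phi_linear).
Qed.

Lemma Lact_skew w :
  skew_symmetric (fun t : N ^ n => nbracket (@snoc N' n.+1 (vmap phi t) w)).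
Proof. by move=> x i j ne; rewrite vmap_swap snoc_skew. Qed.

Lemma Lact_wedge t w :
  Lact (wedge t) w = nbracket (@snoc N' n.+1 (vmap phi t) w).
Proof. exact: (extlift_wedge (Lact_multilinear w) (Lact_skew w)). Qed.

Lemma Lact_linearl w : linear (Lact^~ w).
Proof. exact: (extlift_linear (Lact_multilinear w) (Lact_skew w)). Qed.

Lemma Lact_linearr x : linear (Lact x).
Proof.
move=> a u v; rewrite -extlift_linearl; apply: eq_extlift => t.
exact: snoc_linear.
Qed.

Lemma vmap_id (A : Type) k (t : A ^ k) : vmap id t = t.
Proof. by apply/ffunP=> i; rewrite ffunE. Qed.

Section Derivation1.
Variables (W : lmodType K) (k : nat) (g : N ^ k -> W) (D : N -> N).
Hypotheses (g_lin : multilinear g) (g_skew : skew_symmetric g).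

Lemma deriv1_multilinear :
  linear D -> multilinear (fun y => \sum_(p < k) g (upd y p (D (y p)))).
Proof.
move=> hD x i a u v.
have id_lin : linear (id : N -> N) by [].
by have := deriv_multilinear g_lin id_lin hD x i a u v; rewrite !vmap_id.
Qed.

Lemma deriv1_skew : skew_symmetric (fun y => \sum_(p < k) g (upd y p (D (y p)))).
Proof.
by move=> x i j ne; have := deriv_skew id D g_skew x ne; rewrite !vmap_id.
Qed.

End Derivation1.

Lemma Lbracket_wedge x t :
  Lbracket x (wedge t) = \sum_(i < n) wedge (upd t i (ad x (t i))).
Proof.
apply: (extlift_wedge (deriv1_multilinear _ _) (deriv1_skew _ _)).
- exact: wedge_multilinear.
- exact: ad_linearr.
- exact: wedge_skew.
Qed.

Lemma Lbracket_linearr x : linear (Lbracket x).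
Proof.
apply: (extlift_linear (deriv1_multilinear _ _) (deriv1_skew _ _)).
- exact: wedge_multilinear.
- exact: ad_linearr.
- exact: wedge_skew.
Qed.

Lemma Lbracket_linearl y : linear (Lbracket^~ y).
Proof.
move=> a u v; rewrite -extlift_linearl; apply: eq_extlift => t.
rewrite scaler_sumr -big_split; apply: eq_bigr => i _ /=.
by rewrite ad_linearl wedge_multilinear.
Qed.

Section Delta.
Variables (m : nat) (f : cochain m).

Let psi xs z (t : N ^ n) := \sum_(i < n) nbracket
  (@snoc N' n.+1 (upd (vmap phi t) i (f (omit ord_max xs) (t i))) (phi z)).

Let psi_multilinear xs z : multilinear (psi xs z).
Proof.
apply: (deriv_multilinear (snoc_multilinear (phi z))) => //.
exact: cochain_linear.
Qed.

Let psi_skew xs z : skew_symmetric (psi xs z).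
Proof. exact: (deriv_skew _ _ (snoc_skew (phi z))). Qed.

Lemma delta_fun_wedge (xs : L ^ m.+1) (t : N ^ n) z :
  xs ord_max = wedge t ->
  delta_fun f xs z =
  \sum_(i < m.+1) \sum_(j < m.+1 | (i < j)%N)
     (-1) ^+ i.+1 *: f (omit i (upd xs j (Lbracket (xs i) (xs j)))) z
  + \sum_(i < m.+1) (-1) ^+ i.+1 *: f (omit i xs) (ad (xs i) z)
  + \sum_(i < m.+1) (-1) ^+ i.+2 *: Lact (xs i) (f (omit i xs) z)
  + (-1) ^+ m *: \sum_(i < n) nbracket
      (@snoc N' n.+1 (upd (vmap phi t) i (f (omit ord_max xs) (t i))) (phi z)).
Proof. by move=> e; rewrite /delta_fun e (extlift_wedge (psi_multilinear _ _)). Qed.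

Lemma delta_linear xs : linear (delta_fun f xs).
Proof.
have f_lin ys : linear (f ys) := @cochain_linear m f ys.
apply: lin_add; [apply: lin_add; [apply: lin_add|]|].
- apply: lin_sum => i _; apply: lin_sum => j _; exact: lin_scale.
- apply: lin_sum => i _; apply/lin_scale/lin_comp => //; exact: ad_linearr.
- apply: lin_sum => i _; apply/lin_scale/lin_comp => //; exact: Lact_linearr.
apply: lin_scale => a u v; rewrite -extlift_linearl; apply: eq_extlift => t.
rewrite scaler_sumr -big_split; apply: eq_bigr => i _ /=.
by rewrite linearP snoc_linear.
Qed.

Lemma delta_multilinear z : multilinear (fun xs => delta_fun f xs z).
Proof.
have f_lin ys : linear (f ys) := @cochain_linear m f ys.
have f_mul w : multilinear (fun ys => f ys w) := @cochain_multilinear m f w.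
have f_omit i k xs w : i != k -> linear (fun v => f (omit i (upd xs k v)) w).
  case: (unliftP i k) => [k'|] -> => [_|]; last by rewrite eqxx.
  apply: (@lin_ext _ _ _ _ (fun v => f (upd (omit i xs) k' v) w)).
    by move=> v; rewrite omit_upd_lift.
  exact: f_mul.
move=> xs k; apply: lin_add; [apply: lin_add; [apply: lin_add|]|].
- apply: lin_sum => i _; apply: lin_sum => j lt_ij; apply: lin_scale.
  have ne_ij : i != j by rewrite neq_ltn lt_ij.
  have [<-|ne_jk] := eqVneq j k.
    apply: (@lin_ext _ _ _ _ (fun v => f (omit i (upd xs j (Lbracket (xs i) v))) z)).
      by move=> v; rewrite upd_upd upd_eq upd_neq // eq_sym.
    apply: (@lin_comp _ _ _ _ (fun v => f (omit i (upd xs j v)) z)).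
      exact: f_omit.
    exact: Lbracket_linearr.
  have [<-|ne_ik] := eqVneq i k.
    apply: (@lin_ext _ _ _ _ (fun v => f (omit i (upd xs j (Lbracket v (xs j)))) z)).
      by move=> v; rewrite updC // omit_upd upd_eq upd_neq.
    apply: (@lin_comp _ _ _ _ (fun v => f (omit i (upd xs j v)) z)).
      exact: f_omit.
    exact: Lbracket_linearl.
  apply: (@lin_ext _ _ _ _ (fun v =>
    f (omit i (upd (upd xs j (Lbracket (xs i) (xs j))) k v)) z)).
    have [ne_ki ne_kj] : k != i /\ k != j by rewrite ![k == _]eq_sym.
    by move=> v; rewrite !upd_neq // updC.
  exact: f_omit.
- apply: lin_sum => i _; apply: lin_scale; have [<-|ne_ik] := eqVneq i k.
    apply: (@lin_ext _ _ _ _ (fun v => f (omit i xs) (ad v z))).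
      by move=> v; rewrite omit_upd upd_eq.
    apply: lin_comp => //; exact: ad_linearl.
  apply: (@lin_ext _ _ _ _ (fun v => f (omit i (upd xs k v)) (ad (xs i) z))).
    by move=> v; rewrite upd_neq // eq_sym.
  exact: f_omit.
- apply: lin_sum => i _; apply: lin_scale; have [<-|ne_ik] := eqVneq i k.
    apply: (@lin_ext _ _ _ _ (fun v => Lact v (f (omit i xs) z))).
      by move=> v; rewrite omit_upd upd_eq.
    exact: Lact_linearl.
  apply: (@lin_ext _ _ _ _ (fun v => Lact (xs i) (f (omit i (upd xs k v)) z))).
    by move=> v; rewrite upd_neq // eq_sym.
  apply: lin_comp; [exact: Lact_linearr | exact: f_omit].
apply: lin_scale; have [<-|ne_k] := eqVneq ord_max k.
  apply: (@lin_ext _ _ _ _ (fun v => extlift (psi xs z) v)).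
    by move=> v; rewrite omit_upd upd_eq.
  exact: extlift_linear.
move=> a u v; rewrite ![upd _ _ _ _]upd_neq 1?eq_sym //.
rewrite -extlift_linearl; apply: eq_extlift => t.
rewrite scaler_sumr -big_split; apply: eq_bigr => i _ /=.
by rewrite f_omit // snoc_multilinear.
Qed.

Lemma delta_skew (xs : L ^ m.+1) (l : 'I_m.+1) : l.+1 = m.+1 ->
  skew_symmetric (fun y : N ^ n.+1 =>
    delta_fun f (upd xs l (wedge (front y))) (y ord_max)).
Proof.
have f_lin ys : linear (f ys) := @cochain_linear m f ys.
have f_mul w : multilinear (fun ys => f ys w) := @cochain_multilinear m f w.
case=> l_m; have {l l_m}-> : l = ord_max by apply: val_inj.
pose X (y : N ^ n.+1) := upd xs ord_max (wedge (front y)).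
have X_max y : X y ord_max = wedge (front y) by rewrite /X upd_eq.
have X_lift y i : X y (lift ord_max i) = xs (lift ord_max i).
  by rewrite /X upd_neq ?neq_lift.
pose A (i : 'I_m.+1) (y : N ^ n.+1) := \sum_(j < m.+1 | (i < j)%N)
  f (omit i (upd (X y) j (Lbracket (X y i) (X y j)))) (y ord_max)
  + f (omit i (X y)) (ad (X y i) (y ord_max)).
pose B (i : 'I_m.+1) (y : N ^ n.+1) := Lact (X y i) (f (omit i (X y)) (y ord_max)).
pose F := f (omit ord_max xs).
pose C (y : N ^ n.+1) :=
  \sum_(p < n.+1) nbracket (upd (vmap phi y) p (F (y p))).
suff e : (fun y : N ^ n.+1 => delta_fun f (X y) (y ord_max)) =1 (fun y =>
    \sum_(i < m.+1) (-1) ^+ i.+1 *: A i y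
    + (\sum_(i < m) (-1) ^+ i *: B (lift ord_max i) y + (-1) ^+ m *: C y)).
  apply: (skew_ext e); apply: skew_add; last apply: skew_add.
  - apply: skew_sum => i _; apply: skew_scale.
    case: (unliftP ord_max i) => [i'|] -> {i}; last first.
      apply: (@skew_ext _ _ _ _ _ (fun y => F (nbracket y))) => [y|].
        rewrite /A big_pred0 => [|j]; last by rewrite ltnNge -ltnS ltn_ord.
        by rewrite add0r X_max ad_wedge snoc_front /X omit_upd.
      by apply: skew_lin; [exact: f_lin | exact: nbracket_skew].
    set i := lift ord_max i'.
    have : i != ord_max by rewrite /i eq_sym neq_lift.
    case: (unliftP i ord_max) => [q e_q _|->]; last by rewrite eqxx.
    have q_m : q.+1 = m := lift_ord_max_inv (esym e_q).
    have G_skew ys := @cochain_skew m f ys q q_m.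
    pose G ys (y : N ^ n.+1) := f (upd ys q (wedge (front y))) (y ord_max).
    apply: (@skew_ext _ _ _ _ _ (fun y =>
      \sum_(j < m.+1 | (i < j)%N && (j != ord_max))
         G (omit i (upd xs j (Lbracket (xs i) (xs j)))) y
      + \sum_(p < n.+1) G (omit i xs) (upd y p (ad (xs i) (y p))))) => [y|].
      rewrite /A (bigD1 (ord_max : 'I_m.+1)) /=; last first.
        by rewrite [X in (X < _)%N](lift_max i') ltn_ord.
      rewrite (X_lift y i' : X y i = xs i) [in LHS]addrAC [LHS]addrC; congr (_ + _).
        apply: eq_bigr => j /andP[_ ne_j].
        have -> : X y j = xs j by rewrite /X upd_neq // eq_sym.
        rewrite /X updC 1?eq_sym // /G; congr (f _ _).
        by rewrite -omit_upd_lift -e_q.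
      rewrite big_ord_lift; congr (_ + _).
        rewrite X_max Lbracket_wedge /X upd_upd {1}e_q omit_upd_lift.
        rewrite (lin_bigsum _ _ (f_mul (y ord_max) (omit i xs) q)).
        apply: eq_bigr => p _; rewrite /G front_upd_lift upd_neq 1?eq_sym ?neq_lift //.
        by congr (f (upd _ _ (wedge (upd _ _ _))) _); rewrite ffunE.
      by rewrite /G upd_eq front_upd_last /X {1}e_q omit_upd_lift.
    apply: skew_add; first by apply: skew_sum => j _; apply: G_skew.
    by apply: deriv1_skew; apply: G_skew.
  - apply: skew_sum => i _; apply: skew_scale.
    set i1 := lift ord_max i.
    have : i1 != ord_max by rewrite /i1 eq_sym neq_lift.
    case: (unliftP i1 ord_max) => [q e_q _|->]; last by rewrite eqxx.
    have q_m : q.+1 = m := lift_ord_max_inv (esym e_q).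
    apply: (@skew_ext _ _ _ _ _ (fun y : N ^ n.+1 => Lact (xs i1)
      (f (upd (omit i1 xs) q (wedge (front y))) (y ord_max)))) => [y|].
      by rewrite /B (X_lift y i : X y i1 = xs i1) -omit_upd_lift -e_q.
    apply: skew_lin; [exact: Lact_linearr | exact: (@cochain_skew m f _ q q_m)].
  - by apply: skew_scale; apply: deriv_skew; apply: nbracket_skew.
move=> y; rewrite /delta_fun -big_split /= -addrA; congr (_ + _).
  apply: eq_bigr => i _; rewrite scalerDr; congr (_ + _).
  by rewrite scaler_sumr.
rewrite big_ord_lift -addrA; congr (_ + _).
  apply: eq_bigr => i _; rewrite lift_max /B; congr (_ *: _).
  by rewrite !exprS !mulN1r opprK.
rewrite !exprS !mulN1r opprK -scalerDr; congr (_ *: _).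
rewrite X_max Lact_wedge (extlift_wedge (psi_multilinear _ _)) //.
rewrite /C big_ord_lift addrC /X omit_upd; congr (_ + _).
  rewrite /psi omit_upd; apply: eq_bigr => p _; congr (nbracket _).
  rewrite snoc_upd; congr (upd _ _ _); last by rewrite /F ffunE.
  apply/ffunP=> k; case: (unliftP ord_max k) => [k'|] ->.
    by rewrite snocE_lift !ffunE.
  by rewrite snocE_last ffunE.
congr (nbracket _); rewrite -/F.
apply/ffunP=> k; case: (unliftP ord_max k) => [k'|] ->.
  by rewrite snocE_lift upd_neq ?neq_lift // !ffunE.
by rewrite snocE_last upd_eq.
Qed.

Definition delta : cochain m.+1 :=
  Cochain delta_linear delta_multilinear delta_skew.

End Delta.

End Complex.

(* Main.v *)
Require Import Defs.
From mathcomp Require Import all_boot all_algebra.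
From mathcomp Require Import zify.
From mathcomp Require Import boolp functions.

Set Implicit Arguments.
Unset Strict Implicit.
Unset Printing Implicit Defensive.

Import GRing.Theory.
Local Open Scope ring_scope.

(** The operator delta is the coboundary of a Leibniz algebra, and its square
    vanishes by a Cartan calculus.

    The exterior power L of N is a left Leibniz algebra ([Lbracket_leibniz])
    which acts on N by ad and on N' by Lact, and phi intertwines the two
    actions ([phi_ad]).  Read a cochain f(x_1, ..., x_m, z) as a function of
    x_1, ..., x_m with values in Hom(N, N').  On Hom(N, N') there are two
    operations of x in L: the commutator action [act], which sends g to
    Lact x o g - g o ad x, and the operation [ract], which substitutes g for phi
    in one slot at a time.  For m = 0 the coboundary of g is their sum
    [hom_delta]; on x = wedge t it is the failure of g to be a derivation along
    phi ([hom_delta_wedge]).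

    Let i_x be the insertion of x as first argument ([contract]) and theta_x the
    Lie derivative ([lieder]).  Splitting off the index 1 from all sums in the
    definition of delta gives Cartan's formula
      i_x delta = theta_x - delta i_x   ([contract_delta]),
    which determines delta by recursion on m.  Since
      i_y theta_x = theta_x i_y - i_[x, y]   ([contract_lieder]),
    induction on m yields [theta_x, theta_y] = theta_[x, y]
    ([lieder_bracket], from the Leibniz identity) and
    delta theta_x = theta_x delta ([lieder_delta]).  Then
      i_x delta delta = theta_x delta - delta (theta_x - delta i_x)
                      = delta delta i_x,
    so everything reduces to m = 0.  There
    i_x delta delta f = delta (theta_x f - i_x delta f) = - delta ([ract] x f),
    and this is 0 because [ract] x f is a derivation along phi: for
    x = x^1 /\ ... /\ x^(n-1) it is the sum over i of ad' X_i o phi, where X_i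
    is phi(x^1) /\ ... /\ f(x^i) /\ ... /\ phi(x^(n-1)), and each ad' X_i is a
    derivation by the Nambu identity ([derivation_defect_ract]). *)

(** * Linear maps, exterior powers and derivations *)

Lemma subrACA (V : zmodType) (a b c d : V) : a - b - (c - d) = a - c - (b - d).
Proof. by rewrite !opprD !opprK addrACA. Qed.

Lemma big_ord_pos (V : zmodType) k (P : pred 'I_k.+1) (F : 'I_k.+1 -> V) :
  ~~ P ord0 ->
  \sum_(j < k.+1 | P j) F j = \sum_(j < k | P (lift ord0 j)) F (lift ord0 j).
Proof.
move=> P0; rewrite big_mkcond big_ord_recl (negPf P0) /=.
by rewrite add0r -big_mkcond.
Qed.

Section LinearExtras.
Variables (K : fieldType) (U W : lmodType K).

Lemma lin_sub (f g : U -> W) :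
  linear f -> linear g -> linear (fun u => f u - g u).
Proof. by move=> hf hg a u v; rewrite hf hg scalerBr opprD addrACA. Qed.

Lemma linD (f : U -> W) : linear f -> {morph f : u v / u + v}.
Proof. by move=> hf u v; have := hf 1 u v; rewrite !scale1r. Qed.

Lemma linB (f : U -> W) : linear f -> {morph f : u v / u - v}.
Proof. by move=> hf u v; rewrite linD // lin_opp. Qed.

Lemma extpow_eq n (f g : extpow n U -> W) : linear f -> linear g ->
  (forall t, f (wedge t) = g (wedge t)) -> f =1 g.
Proof.
move=> hf hg e; elim/extpow_ind => [|a t x IH]; first by rewrite !lin0.
by rewrite hf hg e IH.
Qed.

End LinearExtras.

(** The commutator of two Leibniz-rule operators on a multilinear map: one
    substitutes h for phi in one slot, the other applies D (or D') in one slot.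
    When they act on different slots they commute, so only the diagonal
    survives.  Both the Leibniz identity of the exterior power and the
    invariance of [hom_delta] are instances. *)
Lemma deriv_commutator (K : fieldType) (V V' W : lmodType K) k (g : V' ^ k -> W)
    (phi h : V -> V') (D : V -> V) (D' : V' -> V') :
  multilinear g -> (forall v, phi (D v) = D' (phi v)) -> forall y : V ^ k,
  \sum_(i < k) \sum_(p < k) g (upd (upd (vmap phi y) i (h (y i))) p
     (D' (upd (vmap phi y) i (h (y i)) p)))
  - \sum_(p < k) \sum_(i < k) g (upd (vmap phi (upd y p (D (y p)))) i
     (h (upd y p (D (y p)) i)))
  = \sum_(i < k) g (upd (vmap phi y) i (D' (h (y i)) - h (D (y i)))).
Proof.
move=> g_lin phiD y.
rewrite [X in _ - X]exchange_big -sumrB; apply: eq_bigr => i _ /=.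
rewrite [X in X - _](bigD1 i) // [X in _ - X](bigD1 i) //=.
rewrite !upd_eq vmap_upd !upd_upd (linB (g_lin _ _)) /=.
rewrite opprD addrACA -[RHS]addr0; congr (_ + _).
rewrite -sumrB big1 // => p ne_pi.
rewrite vmap_upd phiD updC 1?eq_sym // !upd_neq // 1?eq_sym //.
by rewrite ffunE subrr.
Qed.

Lemma vmap_snoc (T U : Type) (phi : T -> U) n (t : T ^ n) z :
  vmap phi (@snoc T n.+1 t z) = @snoc U n.+1 (vmap phi t) (phi z).
Proof.
apply/ffunP=> k; case: (unliftP ord_max k) => [k'|] ->.
  by rewrite ffunE !snocE_lift ffunE.
by rewrite ffunE !snocE_last.
Qed.

(** * The Leibniz algebra of the exterior power and its representations *)

Section Actions.
Variables (K : fieldType) (n : nat) (N N' : nLieType K n.+1).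
Variable phi : {linear N -> N'}.
Hypothesis hphi : nLie_morphism phi.
Local Notation L := (extpow n N).

(** This is the Nambu identity, extended linearly in x. *)
Lemma Lact_deriv x (y : N' ^ n.+1) : Lact phi x (nbracket y) =
  \sum_(p < n.+1) nbracket (upd y p (Lact phi x (y p))).
Proof.
move: x; apply: extpow_eq => [||t]; first exact: Lact_linearl.
  apply: lin_sum => p _; apply: (lin_comp (nbracket_multilinear y p)).
  exact: Lact_linearl.
rewrite Lact_wedge (nbracket_nambu (vmap phi t : N' ^ n.+1.-1)).
by apply: eq_bigr => p _; rewrite Lact_wedge.
Qed.

Lemma phi_ad x z : phi (ad x z) = Lact phi x (phi z).
Proof.
move: x; apply: extpow_eq => [||t].
- by apply: lin_comp; [exact: linearP | exact: ad_linearl].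
- exact: Lact_linearl.
by rewrite ad_wedge Lact_wedge hphi vmap_snoc.
Qed.

(** Apply the derivation Lact x to the bracket that defines Lact y w: the slots
    of y give the action of [x, y], the last slot gives Lact y (Lact x w). *)
Lemma Lact_bracket x y w :
  Lact phi (Lbracket x y) w =
  Lact phi x (Lact phi y w) - Lact phi y (Lact phi x w).
Proof.
move: y; apply: extpow_eq => [||t].
- by apply: lin_comp; [exact: Lact_linearl | exact: Lbracket_linearr].
- apply: lin_sub; last exact: Lact_linearl.
  by apply: lin_comp; [exact: Lact_linearr | exact: Lact_linearl].
rewrite Lbracket_wedge (lin_bigsum _ _ (Lact_linearl phi w)).
rewrite !Lact_wedge Lact_deriv big_ord_lift snocE_last -snoc_updr addrK.
apply: eq_bigr => i _.
by rewrite Lact_wedge vmap_upd phi_ad snocE_lift snoc_upd ffunE.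
Qed.

End Actions.

Section Adjoint.
Variables (K : fieldType) (n : nat) (N : nLieType K n.+1).
Local Notation L := (extpow n N).
Implicit Types x y : L.

(** The adjoint action is the case phi = id of Lact, so that it inherits the
    properties of Lact. *)
Lemma ad_Lact x (w : N) : ad x w = Lact (idfun : {linear N -> N}) x w.
Proof. by apply: eq_extlift => t; rewrite vmap_id. Qed.

Lemma ad_deriv x (y : N ^ n.+1) :
  ad x (nbracket y) = \sum_(p < n.+1) nbracket (upd y p (ad x (y p))).
Proof.
by rewrite ad_Lact Lact_deriv; apply: eq_bigr => p _; rewrite ad_Lact.
Qed.

Lemma id_nLie_morphism : nLie_morphism (idfun : {linear N -> N}).
Proof. by move=> x; rewrite vmap_id. Qed.

Lemma ad_bracket x y (w : N) :
  ad (Lbracket x y) w = ad x (ad y w) - ad y (ad x w).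
Proof. by rewrite !ad_Lact Lact_bracket //; exact: id_nLie_morphism. Qed.

(** On z = wedge t, the operators [x, .] and [y, .] act by ad x and ad y in one
    slot at a time, so their commutator acts by [ad x, ad y] = ad [x, y]. *)
Lemma Lbracket_leibniz x y z :
  Lbracket (Lbracket x y) z =
  Lbracket x (Lbracket y z) - Lbracket y (Lbracket x z).
Proof.
move: z; apply: extpow_eq => [||t]; first exact: Lbracket_linearr.
  by apply: lin_sub; apply: lin_comp; exact: Lbracket_linearr.
rewrite !Lbracket_wedge (lin_bigsum _ _ (Lbracket_linearr x)).
rewrite (lin_bigsum _ _ (Lbracket_linearr y)).
have h := deriv_commutator (ad y) (@wedge_multilinear K n N)
  (fun v => erefl : id (ad x v) = ad x (id v)) t.
rewrite vmap_id in h.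
transitivity (\sum_(i < n)
    wedge (upd t i (ad x (ad y (t i)) - ad y (ad x (t i))))).
  by apply: eq_bigr => i _; rewrite ad_bracket.
rewrite -h; congr (_ - _); apply: eq_bigr => i _; rewrite Lbracket_wedge //.
by apply: eq_bigr => j _; rewrite vmap_id.
Qed.

End Adjoint.

(** * The coefficients Hom(N, N') *)

Section Coefficients.
Variables (K : fieldType) (n : nat) (N N' : nLieType K n.+1).
Variable phi : {linear N -> N'}.
Hypothesis hphi : nLie_morphism phi.
Local Notation L := (extpow n N).
Implicit Types (x y : L) (g h : N -> N').

Definition act x g : N -> N' := fun z => Lact phi x (g z) - g (ad x z).

(** The last sum in the definition of delta, up to its sign.  It is the
    coefficient of e in Lact x (phi z) when phi is replaced by phi + e g in the
    action Lact only. *)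
Definition ract x g : N -> N' := fun z =>
  extlift (fun t : N ^ n => \sum_(i < n) nbracket
    (@snoc N' n.+1 (upd (vmap phi t) i (g (t i))) (phi z))) x.

(** The coboundary of a cochain with m = 0 ([delta_fun0]). *)
Definition hom_delta x g : N -> N' := act x g + ract x g.

Definition derivation_defect g (y : N ^ n.+1) : N' :=
  \sum_(p < n.+1) nbracket (upd (vmap phi y) p (g (y p))) - g (nbracket y).

Lemma act_linear x g : linear g -> linear (act x g).
Proof.
move=> hg; apply: lin_sub; apply: lin_comp => //; first exact: Lact_linearr.
exact: ad_linearr.
Qed.

Lemma act_linearl g z : linear g -> linear (fun x => act x g z).
Proof.
move=> hg; apply: lin_sub; first exact: Lact_linearl.
by apply: lin_comp => //; exact: ad_linearl.
Qed.

Lemma ract_linear x g : linear (ract x g).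
Proof.
move=> a u v; rewrite -extlift_linearl; apply: eq_extlift => t.
rewrite scaler_sumr -big_split; apply: eq_bigr => i _ /=.
by rewrite linearP snoc_linear.
Qed.

Lemma ract_multilinear g z : linear g -> multilinear (fun t : N ^ n =>
  \sum_(i < n) nbracket (@snoc N' n.+1 (upd (vmap phi t) i (g (t i))) (phi z))).
Proof.
move=> hg.
by apply: (deriv_multilinear (snoc_multilinear (phi z)) (linearP phi)).
Qed.

Lemma ract_skew g z : skew_symmetric (fun t : N ^ n =>
  \sum_(i < n) nbracket (@snoc N' n.+1 (upd (vmap phi t) i (g (t i))) (phi z))).
Proof. exact: (deriv_skew _ _ (snoc_skew (phi z))). Qed.

Lemma ract_linearl g z : linear g -> linear (fun x => ract x g z).
Proof.
move=> hg.
by apply: extlift_linear; [exact: ract_multilinear | exact: ract_skew].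
Qed.

Lemma ract_wedge t g z : linear g -> ract (wedge t) g z =
  \sum_(i < n) nbracket (@snoc N' n.+1 (upd (vmap phi t) i (g (t i))) (phi z)).
Proof.
move=> hg.
by apply: extlift_wedge; [exact: ract_multilinear | exact: ract_skew].
Qed.

Lemma actB x : {morph act x : g h / g - h}.
Proof.
move=> g h; apply/funext => z; rewrite /act !fctE (linB (Lact_linearr phi x)).
exact: subrACA.
Qed.

Lemma ractB x : {morph ract x : g h / g - h}.
Proof.
move=> g h; apply/funext => z; rewrite !fctE -[- ract _ _ _]scaleN1r addrC.
rewrite -extlift_linearl; apply: eq_extlift => t.
rewrite scaler_sumr -big_split; apply: eq_bigr => i _ /=.
rewrite scaleN1r [RHS]addrC.
by rewrite (linB (@snoc_multilinear K n N' (phi z) (vmap phi t) i)).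
Qed.

Lemma hom_deltaB x : {morph hom_delta x : g h / g - h}.
Proof.
by move=> g h; rewrite /hom_delta actB ractB (opprD (act x h)) addrACA.
Qed.

Lemma hom_delta_linearl g z : linear g -> linear (fun x => hom_delta x g z).
Proof.
by move=> hg; apply: lin_add; [exact: act_linearl | exact: ract_linearl].
Qed.

Lemma hom_delta_wedge t g z : linear g ->
  hom_delta (wedge t) g z = derivation_defect g (@snoc N n.+1 t z).
Proof.
move=> hg; rewrite /hom_delta !fctE ract_wedge // /act /derivation_defect.
rewrite ad_wedge Lact_wedge addrAC; congr (_ - _).
rewrite big_ord_lift addrC vmap_snoc snocE_last -snoc_updr; congr (_ + _).
by apply: eq_bigr => i _; rewrite snocE_lift snoc_upd.
Qed.

Lemma act_bracket x y g : linear g ->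
  act (Lbracket x y) g = act x (act y g) - act y (act x g).
Proof.
move=> hg; apply/funext => z; rewrite /act !fctE Lact_bracket // ad_bracket.
rewrite (linB hg) !(linB (Lact_linearr phi _)) !opprD !opprK.
set a := Lact _ x _; set b := Lact _ y (Lact _ x _); set c := g (ad x _).
set d := g (ad y _); set e := Lact _ x _; set e' := Lact _ y _.
by rewrite [RHS](AC (2*2*(2*2)) (1*5*(8*4)*(7*2)*(6*3)))/= !subrr !addr0.
Qed.

(** The defect is natural in g: bracket and phi are invariant under L, so
    commuting Lact x with the derivation ad x of the arguments only affects g.
    For the terms with g in one slot this is [deriv_commutator]. *)
Lemma derivation_defect_act x g (y : N ^ n.+1) : linear g ->
  derivation_defect (act x g) y = Lact phi x (derivation_defect g y)
    - \sum_(p < n.+1) derivation_defect g (upd y p (ad x (y p))).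
Proof.
move=> hg; rewrite /derivation_defect sumrB (linB (Lact_linearr phi x)).
rewrite (lin_bigsum _ _ (Lact_linearr phi x)).
under [X in _ = X - _ - _]eq_bigr => p _ do rewrite Lact_deriv //.
rewrite [X in _ = _ + X]opprD opprK [RHS]addrACA.
rewrite (deriv_commutator g (@nbracket_multilinear K n.+1 N')); last first.
  exact: phi_ad.
congr (_ + _); rewrite /act opprB addrC; congr (_ - _).
by rewrite ad_deriv (lin_bigsum _ _ hg).
Qed.

(** The case m = 0 of the commutation of delta with the Lie derivative.  The
    terms p < n of [derivation_defect_act] assemble to the action of [x, y],
    the term p = n to ad x acting on the argument z. *)
Lemma hom_delta_act x y g : linear g ->
  hom_delta y (act x g) = act x (hom_delta y g) - hom_delta (Lbracket x y) g.
Proof.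
move=> hg; apply/funext => z; rewrite !fctE; move: y; apply: extpow_eq.
- by apply: hom_delta_linearl; exact: act_linear.
- apply: lin_sub.
    apply: lin_sub; last exact: hom_delta_linearl.
    by apply: lin_comp; [exact: Lact_linearr | exact: hom_delta_linearl].
  exact: (lin_comp (hom_delta_linearl z hg) (Lbracket_linearr x)).
move=> t; rewrite hom_delta_wedge; last exact: act_linear.
rewrite derivation_defect_act // /act !hom_delta_wedge // -addrA -opprD.
congr (_ - _).
rewrite big_ord_lift addrC snocE_last -snoc_updr; congr (_ + _).
rewrite Lbracket_wedge (lin_bigsum _ _ (hom_delta_linearl z hg)).
by apply: eq_bigr => i _; rewrite hom_delta_wedge // snocE_lift snoc_upd.
Qed.

(** For x = wedge t, [ract x g] is a sum of maps ad' X o phi.  Each is a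
    derivation along phi: phi is a morphism, and ad' X is a derivation of the
    bracket of N' by the Nambu identity. *)
Lemma derivation_defect_ract x g (y : N ^ n.+1) : linear g ->
  derivation_defect (ract x g) y = 0.
Proof.
move=> hg; move: x; apply: extpow_eq => [||t].
- apply: lin_sub; last exact: ract_linearl.
  apply: lin_sum => p _; apply: (lin_comp (nbracket_multilinear _ _)).
  exact: ract_linearl.
- by move=> a u v; rewrite scaler0 addr0.
rewrite /derivation_defect ract_wedge // hphi.
under eq_bigr => p _.
  rewrite ract_wedge // (lin_bigsum _ _ (nbracket_multilinear _ _)).
  over.
rewrite exchange_big -sumrB big1 // => i _ /=.
rewrite (nbracket_nambu (_ : N' ^ n.+1.-1)).
apply/eqP; rewrite subr_eq0; apply/eqP.
by apply: eq_bigr => p _; rewrite ffunE.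
Qed.

Lemma hom_delta_ract x y g : linear g -> hom_delta y (ract x g) = 0.
Proof.
move=> hg; apply/funext => z; move: y; apply: extpow_eq => [||t].
- by apply: hom_delta_linearl; exact: ract_linear.
- by move=> a u v; rewrite scaler0 addr0.
by rewrite hom_delta_wedge ?derivation_defect_ract //; exact: ract_linear.
Qed.

End Coefficients.

(** * Prepending a vector *)

Section Prepend.
Variable T : Type.
Implicit Type x : T.

Definition vcons m x (xs : T ^ m) : T ^ m.+1 :=
  [ffun i => oapp xs x (unlift ord0 i)].

Lemma vcons0 m x (xs : T ^ m) : vcons x xs ord0 = x.
Proof. by rewrite ffunE unlift_none. Qed.

Lemma vconsS m x (xs : T ^ m) i : vcons x xs (lift ord0 i) = xs i.
Proof. by rewrite ffunE liftK. Qed.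

Lemma vcons_upd0 m x y (xs : T ^ m) : upd (vcons x xs) ord0 y = vcons y xs.
Proof.
apply/ffunP=> i; case: (unliftP ord0 i) => [j|] ->.
  by rewrite upd_neq ?neq_lift // !vconsS.
by rewrite upd_eq vcons0.
Qed.

Lemma vcons_upd m x (xs : T ^ m) i y :
  vcons x (upd xs i y) = upd (vcons x xs) (lift ord0 i) y.
Proof.
apply/ffunP=> k; case: (unliftP ord0 k) => [j|] ->.
  by rewrite vconsS !updE (inj_eq lift_inj) vconsS.
by rewrite vcons0 upd_neq ?vcons0 // eq_sym neq_lift.
Qed.

Lemma omit_vcons0 m x (xs : T ^ m) : omit ord0 (vcons x xs) = xs.
Proof. by apply/ffunP=> i; rewrite ffunE vconsS. Qed.

Lemma omit_vcons m x (xs : T ^ m.+1) i :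
  omit (lift ord0 i) (vcons x xs) = vcons x (omit i xs).
Proof.
apply/ffunP=> k; rewrite ffunE; case: (unliftP ord0 k) => [j|] ->.
  have -> : lift (lift ord0 i) (lift ord0 j) = lift ord0 (lift i j).
    by apply: val_inj; rewrite /= /bump /=; case: leqP; case: leqP => //=; lia.
  by rewrite !vconsS ffunE.
have -> : lift (lift ord0 i) ord0 = ord0 by apply: val_inj.
by rewrite !vcons0.
Qed.

Lemma vcons_surj m (xs : T ^ m.+1) : xs = vcons (xs ord0) (omit ord0 xs).
Proof.
apply/ffunP=> i; case: (unliftP ord0 i) => [j|] ->.
  by rewrite vconsS ffunE.
by rewrite vcons0.
Qed.

End Prepend.

(** * Cartan calculus *)

Section Cartan.
Variables (K : fieldType) (n : nat) (N N' : nLieType K n.+1).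
Variable phi : {linear N -> N'}.
Hypothesis hphi : nLie_morphism phi.
Local Notation L := (extpow n N).
Local Notation C m := (L ^ m -> N -> N').
Implicit Types x y : L.

Definition contract m x (f : C m.+1) : C m := fun xs => f (vcons x xs).

Lemma contract_ext m (f g : C m.+1) :
  (forall x, contract x f = contract x g) -> f = g.
Proof.
move=> e; apply/funext=> xs; rewrite (vcons_surj xs).
exact: (congr1 (@^~ _) (e _)).
Qed.

Definition lieder m x (f : C m) : C m := fun xs =>
  act phi x (f xs) - \sum_(i < m) f (upd xs i (Lbracket x (xs i))).

Local Notation d := (delta_fun phi).

(** The Leibniz identity enters the calculus through insertions such as
    i_[x, [y, z]], hence cochains have to be additive in every argument. *)
Definition multilin m (f : C m) :=
  (forall xs, linear (f xs)) /\ forall z, multilinear (fun xs => f xs z).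

Lemma multilin_contract m x (f : C m.+1) :
  multilin f -> multilin (contract x f).
Proof.
move=> [f_lin f_mul]; split=> [xs|z xs i]; first exact: f_lin.
apply: (lin_ext (fun v => congr1 (f ^~ z) (vcons_upd x xs i v))).
exact: f_mul.
Qed.

Lemma contractB m x y (f : C m.+1) : multilin f ->
  contract (x - y) f = contract x f - contract y f.
Proof.
move=> [_ f_mul]; apply/funext=> xs; apply/funext=> z; rewrite !fctE /contract.
have := linB (f_mul z (vcons 0 xs) ord0) x y.
by rewrite !vcons_upd0.
Qed.

Lemma liederB m x : {morph @lieder m x : f g / f - g}.
Proof.
move=> f g; apply/funext=> xs; rewrite /lieder !fctE actB sumrB.
exact: subrACA.
Qed.

Lemma delta_funB m : {morph @delta_fun K n N N' phi m : f g / f - g}.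
Proof.
move=> f g; apply/funext=> xs; apply/funext=> z; rewrite /delta_fun !fctE.
rewrite !opprD [RHS](AC (4*4) ((1*5)*(2*6)*(3*7)*(4*8)))/=.
congr (_ + _ + _ + _).
- rewrite -sumrB; apply: eq_bigr => i _; rewrite -sumrB.
  by apply: eq_bigr => j _; rewrite !fctE scalerBr.
- by rewrite -sumrB; apply: eq_bigr => i _; rewrite !fctE scalerBr.
- rewrite -sumrB; apply: eq_bigr => i _.
  by rewrite !fctE (linB (Lact_linearr phi _)) scalerBr.
rewrite -scalerBr; congr (_ *: _).
have := ractB phi (xs ord_max) (f (omit ord_max xs)) (g (omit ord_max xs)).
exact: (congr1 (@^~ z)).
Qed.

Lemma contract_lieder m x y (f : C m.+1) :
  contract y (lieder x f) = lieder x (contract y f) - contract (Lbracket x y) f.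
Proof.
apply/funext=> xs; rewrite {1}/contract {1}/lieder big_ord_recl.
rewrite vcons0 vcons_upd0.
rewrite (opprD (f _)) addrA addrAC; congr (_ - _ - _).
by apply: eq_bigr => i _; rewrite vconsS -vcons_upd.
Qed.

Lemma delta_fun0 (f : C 0) xs :
  d f xs = hom_delta phi (xs ord0) (f (omit ord0 xs)).
Proof.
apply/funext=> z; rewrite /delta_fun !big_ord1 big_pred0 => [|j]; last first.
  by rewrite (ord1 j).
rewrite add0r /= expr1 !expr0 !scaleN1r !exprS expr0 mulr1 mulN1r opprK.
rewrite !scale1r.
rewrite /hom_delta !fctE /act [X in X + _]addrC.
by have -> : ord_max = ord0 :> 'I_1 by apply: val_inj.
Qed.

(** Cartan's formula.  In each sum of the definition of delta, the terms with
    i = 1 give the Lie derivative; the others are those of delta (i_x f) with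
    the index shifted by one, hence with the opposite sign. *)
Lemma contract_delta m x (f : C m.+1) :
  contract x (d f) = lieder x f - d (contract x f).
Proof.
apply/funext=> xs; apply/funext=> z.
(* A collects the brackets [x, x_j]: the terms of the double sum with i = 1 *)
pose A := \sum_(j < m.+1) f (upd xs j (Lbracket x (xs j))) z.
transitivity (Lact phi x (f xs z) - f xs (ad x z) - A - d (contract x f) xs z);
  last first.
  rewrite /lieder /A !fctE; congr (_ - _ - _).
  (* a sum of functions is evaluated at z term by term *)
  by elim/big_rec2: _ => // j u v _ ->.
rewrite [LHS]/delta_fun [X in X + _ + _ + _]big_ord_recl.
rewrite [X in _ + X + _ + _]big_ord_recl [X in _ + _ + X + _]big_ord_recl.
rewrite big_ord_pos // vcons0 omit_vcons0.
rewrite expr1 expr2 mulrNN mulr1 scale1r scaleN1r.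
have -> : \sum_(j < m.+1 | ((ord0 : 'I_m.+2) < lift ord0 j)%N)
    (-1 : K) *: f (omit ord0 (upd (vcons x xs) (lift ord0 j)
      (Lbracket x (vcons x xs (lift ord0 j))))) z = - A.
  rewrite /A -sumrN; apply: eq_big => [j|j _] //=.
  by rewrite scaleN1r -vcons_upd omit_vcons0 vconsS.
have -> : ord_max = lift ord0 ord_max :> 'I_m.+2 by apply: val_inj.
have signS i : (-1) ^+ i.+1 = - (-1) ^+ i :> K by rewrite exprS mulN1r.
rewrite vconsS omit_vcons signS scaleNr.
rewrite [in RHS]/delta_fun !opprD.
rewrite [LHS](AC (2*2*2*1) ((5*3*1)*2*4*6*7))/=.
rewrite [RHS](AC (3*4) ((1*2*3)*4*5*6*7))/=.
congr (_ + _ + _ + _ + _).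
- rewrite -sumrN; apply: eq_bigr => i _; rewrite big_ord_pos // -sumrN.
  apply: eq_big => [j|j _] //.
  by rewrite -[bump 0 i]/(i.+1) signS scaleNr !vconsS -vcons_upd omit_vcons.
- rewrite -sumrN; apply: eq_bigr => i _.
  by rewrite -[bump 0 i]/(i.+1) signS scaleNr vconsS omit_vcons.
- rewrite -sumrN; apply: eq_bigr => i _.
  by rewrite -[bump 0 i]/(i.+1) signS scaleNr vconsS omit_vcons.
Qed.

Lemma lieder0 x (f : C 0) xs : lieder x f xs = act phi x (f xs).
Proof. by rewrite /lieder big_ord0 subr0. Qed.

(** By induction on m: after insertion of z and use of the induction hypothesis,
    what remains is that inserting [[x, y], z] and inserting
    [x, [y, z]] - [y, [x, z]] give the same cochain. *)
Lemma lieder_bracket m x y (f : C m) : multilin f ->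
  lieder (Lbracket x y) f = lieder x (lieder y f) - lieder y (lieder x f).
Proof.
elim: m f => [|m IH] f f_ml.
  apply/funext=> xs; rewrite lieder0 act_bracket //; last by case: f_ml.
  by rewrite !fctE !lieder0.
apply: contract_ext => z.
have -> : contract z (lieder x (lieder y f) - lieder y (lieder x f)) =
  contract z (lieder x (lieder y f)) - contract z (lieder y (lieder x f)) by [].
rewrite !contract_lieder IH; last exact: multilin_contract.
rewrite Lbracket_leibniz contractB // !liederB.
have alg (V : zmodType) (a b c e u v : V) :
    a - b - (u - v) = a - c - (e - v) - (b - e - (c - u)).
  rewrite !opprB [RHS](AC (2*2*(2*2)) (1*8*(3*6)*(5*2)*(7*4)))/=.
  by rewrite !subrr !addr0.
exact: alg.
Qed.

(** By induction on m: inserting y and using Cartan's formula reduces the claim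
    to [theta_x, theta_y] = theta_[x, y] and to the same claim for i_y f. *)
Lemma lieder_delta m x (f : C m) :
  multilin f -> d (lieder x f) = lieder x (d f).
Proof.
elim: m f => [|m IH] f f_ml; apply: contract_ext => y.
  apply/funext=> xs; rewrite /contract delta_fun0 vcons0 lieder0 omit_vcons0.
  rewrite hom_delta_act //; last by case: f_ml.
  rewrite -[RHS]/(contract y (lieder x (d f)) xs) contract_lieder.
  rewrite -[RHS]/(_ xs - contract (Lbracket x y) (d f) xs) lieder0 /contract.
  by rewrite !delta_fun0 !vcons0 !omit_vcons0.
rewrite contract_delta contract_lieder delta_funB IH; last first.
  exact: multilin_contract.
rewrite contract_lieder !contract_delta liederB.
rewrite (lieder_bracket x y f_ml).
have alg (V : zmodType) (a b c e : V) : a - (b - c) = e - b - (e - a - c).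
  by rewrite !opprB [RHS](AC (2*(1*2)) (4*(3*2)*(1*5)))/= subrr addr0.
exact: alg.
Qed.

(** Inserting x moves delta delta from f to i_x f.  At m = 0 there is no i_x f;
    there theta_x f - i_x delta f is - [ract x f], which [hom_delta] kills. *)
Lemma delta_fun_delta_fun m (f : C m) : multilin f -> d (d f) = 0.
Proof.
elim: m f => [|m IH] f f_ml; apply: contract_ext => x.
  rewrite contract_delta -lieder_delta // -delta_funB.
  apply/funext=> xs; rewrite delta_fun0.
  have -> ys : (lieder x f - contract x (d f)) ys = - ract phi x (f ys).
    rewrite -[LHS]/(lieder x f ys - contract x (d f) ys) lieder0 /contract.
    by rewrite delta_fun0 vcons0 omit_vcons0 /hom_delta opprD addrA subrr sub0r.
  rewrite -[- _]sub0r hom_deltaB hom_delta_ract // ?subr0; last by case: f_ml.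
  by rewrite -(subrr 0) hom_deltaB subrr.
rewrite contract_delta -lieder_delta // -delta_funB contract_delta.
rewrite opprB addrC subrK IH //; exact: multilin_contract.
Qed.

End Cartan.

Theorem proposition2p2 (K : closedFieldType) (char0 : [pchar K] =i pred0)
    (n : nat) (hn : (2 <= n.+1)%N) (N N' : nLieType K n.+1)
    (phi : {linear N -> N'}) (hphi : nLie_morphism phi)
    (m : nat) (f : cochain N N' m) :
  forall (xs : extpow n N ^ m.+2) (z : N), delta phi (delta phi f) xs z = 0.
Proof.
move=> xs z; have f_ml : multilin f.
  by split=> [ys|w]; [exact: cochain_linear | exact: cochain_multilinear].
exact: (congr1 (fun F => F xs z) (delta_fun_delta_fun hphi f_ml)).
Qed.
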